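(* Let $A\in\mathbb{M}_n(\mathbb{C})$ with $k=\mathrm{ind}(A)\le 2$, and suppose that $A$ is $k$-EP, i.e. $A^kA^\dagger=A^\dagger A^k$. Then $A^{\mathrm{cep}}=A^D$, and consequently $A$ is CEPD.
   Context: $\mathbb{M}_n(\mathbb{C})$ is the algebra of $n\times n$ complex matrices; $^*$ is conjugate transpose; $\mathcal{R}(\cdot)$ is column space; $A^0=I$. The index $\mathrm{ind}(A)$ is the smallest integer $k\ge 0$ with $\mathrm{rank}(A^k)=\mathrm{rank}(A^{k+1})$. $A^\dagger$ is the Moore-Penrose inverse. With $k=\mathrm{ind}(A)$, the Drazin inverse $A^D$ is the unique $X$ with $AX=XA$, $XAX=X$, $XA^{k+1}=A^k$. The core EP inverse of $A$, denoted here $A^{\mathrm{cep}}$, is the unique $X\in\mathbb{M}_n(\mathbb{C})$ with $XAX=X$ and $\mathcal{R}(X)=\mathcal{R}(A^k)=\mathcal{R}(X^* )$. $A$ is called core EP Drazin (CEPD) if $A^{\mathrm{cep}}A^D=A^DA^{\mathrm{cep}}$. *)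

(* Defs.v *)
From mathcomp Require Import all_boot all_order all_algebra.
From mathcomp Require Import complex reals.

Set Implicit Arguments.
Unset Strict Implicit.
Unset Printing Implicit Defensive.

Import Order.TTheory GRing.Theory Num.Theory.
Local Open Scope ring_scope.
Local Open Scope sesquilinear_scope.

(* MathComp's (_ <= _)%MS and (_ == _)%MS compare row spaces, hence the
   (unconjugated) transposes. *)
Definition same_colspace (F : fieldType) (m n p : nat)
    (X : 'M[F]_(m, n)) (Y : 'M[F]_(m, p)) : bool :=
  (X^T == Y^T)%MS.

Lemma colspace_subP (F : fieldType) (m n p : nat)
    (X : 'M[F]_(m, n)) (Y : 'M[F]_(m, p)) :
  reflect (exists Z, X = Y *m Z) (X^T <= Y^T)%MS.
Proof.
apply: (iffP submxP) => [[D e]|[Z ->]]; last by exists Z^T; rewrite trmx_mul.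
by exists D^T; apply: trmx_inj; rewrite trmx_mul trmxK.
Qed.

Lemma same_colspaceP (F : fieldType) (m n p : nat)
    (X : 'M[F]_(m, n)) (Y : 'M[F]_(m, p)) :
  reflect ((exists Z, X = Y *m Z) /\ (exists Z, Y = X *m Z))
          (same_colspace X Y).
Proof.
by apply: (iffP andP) => -[/colspace_subP h1 /colspace_subP h2]; split.
Qed.

Section Index.
Variables (F : fieldType) (n : nat).
Implicit Type A : 'M[F]_n.

Lemma mxindex_exists A : exists k : nat, \rank (A ^+ k) == \rank (A ^+ k.+1).
Proof.
suff H r : forall k, (\rank (A ^+ k)%R <= r)%N ->
    exists k : nat, \rank (A ^+ k) == \rank (A ^+ k.+1).
  exact: (H _ 0%N (leqnn _)).
elim: r => [|r IHr] k hk; have hS : (\rank (A ^+ k.+1) <= \rank (A ^+ k))%N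
  by rewrite exprS -mulmxE mxrankM_maxr.
- by exists k; rewrite eqn_leq hS andbT (leq_trans hk).
- case: (eqVneq (\rank (A ^+ k)) (\rank (A ^+ k.+1))) => [e|ne].
    by exists k; rewrite e.
  apply: (IHr k.+1); rewrite -ltnS; apply: leq_trans hk.
  by rewrite ltn_neqAle eq_sym ne.
Qed.

Definition mxindex A : nat := ex_minn (mxindex_exists A).

Lemma mxindexP A : \rank (A ^+ mxindex A) = \rank (A ^+ (mxindex A).+1).
Proof. by rewrite /mxindex; case: ex_minnP => k /eqP. Qed.

Lemma mxindex_min A (k : nat) :
  \rank (A ^+ k) = \rank (A ^+ k.+1) -> (mxindex A <= k)%N.
Proof. by rewrite /mxindex; case: ex_minnP => j _ + /eqP => /[apply]. Qed.

End Index.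

Section Drazin.
Variables (F : fieldType) (n : nat).
Implicit Types A X : 'M[F]_n.

Definition is_drazin A X : bool :=
  [&& A *m X == X *m A,
      X *m A *m X == X &
      X *m A ^+ (mxindex A).+1 == A ^+ mxindex A].

Lemma drazin_exists A : exists X, is_drazin A X.
Proof.
rewrite /is_drazin; set k := mxindex A; have ek := mxindexP A.
rewrite -/k in ek.
have [U eU] : exists U, A ^+ k = U * A ^+ k.+1.
  apply/submxP; have s : (A ^+ k.+1 <= A ^+ k)%MS.
    by rewrite exprS -mulmxE submxMl.
  by rewrite -(geq_leqif (mxrank_leqif_sup s)) ek.
have [V eV] : exists V, A ^+ k = A ^+ k.+1 * V.
  apply/colspace_subP; have s : ((A ^+ k.+1)^T <= (A ^+ k)^T)%MS.
    by apply/colspace_subP; exists A; rewrite mulmxE exprSr.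
  by rewrite -(geq_leqif (mxrank_leqif_sup s)) !mxrank_tr ek.
have UA j : U ^+ j * A ^+ (k + j) = A ^+ k.
  elim: j => [|j IH]; first by rewrite mul1r addn0.
  rewrite exprSr -mulrA addnS -addSn exprD (mulrA U) -eU -exprD.
  exact: IH.
have AV j : A ^+ (k + j) * V ^+ j = A ^+ k.
  elim: j => [|j IH]; first by rewrite mulr1 addn0.
  rewrite exprS mulrA addnS -addSn addnC exprD -(mulrA _ _ V) -eV -exprD addnC.
  exact: IH.
have UV j : U ^+ j * A ^+ k = A ^+ k * V ^+ j.
  by rewrite -{1}(AV j) mulrA UA.
have UA' j : U ^+ j.+1 * A ^+ k * A = U ^+ j * A ^+ k.
  by rewrite -mulrA -exprSr exprSr -mulrA -eU.
have AV' j : A * (A ^+ k * V ^+ j.+1) = A ^+ k * V ^+ j.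
  by rewrite mulrA -exprS [V ^+ _]exprS mulrA -eV.
exists (U ^+ k.+1 * A ^+ k); rewrite !mulmxE; apply/and3P; split; apply/eqP.
- by rewrite {1}UV AV' UA' UV.
- by rewrite UA' (UV k.+1) mulrA -(mulrA (U ^+ k)) -exprD UA -UV.
- by rewrite -mulrA -exprD addnS -addnS UA.
Qed.

Lemma is_drazin_uniq A X Y : is_drazin A X -> is_drazin A Y -> X = Y.
Proof.
rewrite /is_drazin !mulmxE; set k := mxindex A.
move=> /and3P[/eqP cX /eqP iX /eqP kX] /and3P[/eqP cY /eqP iY /eqP kY].
have idem Z : Z * A * Z = Z -> (Z * A) ^+ k.+1 = Z * A.
  by move=> h; elim: (k) => [//|j IH]; rewrite exprS IH mulrA h.
have pw Z : Z * A * Z = Z -> A * Z = Z * A -> Z ^+ k.+1 * A ^+ k.+1 = Z * A.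
  by move=> h c; rewrite -exprMn_comm ?idem //; apply: esym.
have pw' Z : Z * A * Z = Z -> A * Z = Z * A -> A ^+ k.+1 * Z ^+ k.+1 = Z * A.
  by move=> h c; rewrite -exprMn_comm // c idem.
have absl Z : A * Z = Z * A -> Z * A ^+ k.+1 = A ^+ k ->
    Z * A * A ^+ k.+1 = A ^+ k.+1.
  by move=> c h; rewrite -c -mulrA h -exprS.
have absr Z : A * Z = Z * A -> Z * A ^+ k.+1 = A ^+ k ->
    A ^+ k.+1 * (Z * A) = A ^+ k.+1.
  move=> c h; rewrite mulrA.
  have -> : A ^+ k.+1 * Z = Z * A ^+ k.+1 by apply/esym/commrX/esym.
  by rewrite h -exprSr.
have e1 : X * A = X * A * (Y * A) by rewrite -{2}(pw X) // -mulrA absr // pw.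
have e2 : Y * A = X * A * (Y * A) by rewrite -{2}(pw' Y) // mulrA absl // pw'.
have e : X * A = Y * A by rewrite {1}e1 -e2.
by rewrite -iX e -mulrA cX e -cY mulrA iY.
Qed.

Definition drazin A : 'M[F]_n := xchoose (drazin_exists A).

Lemma drazinP A : is_drazin A (drazin A).
Proof. exact: (xchooseP (drazin_exists A)). Qed.

End Drazin.

Section ConjTranspose.
Variable C : numClosedFieldType.

Lemma trmxC_mul (m n p : nat) (A : 'M[C]_(m, n)) (B : 'M[C]_(n, p)) :
  (A *m B)^t* = B^t* *m A^t*.
Proof. by rewrite trmx_mul map_mxM. Qed.

Lemma gram_eq0 (m n : nat) (A : 'M[C]_(m, n)) : A *m A^t* = 0 -> A = 0.
Proof.
move=> h; apply/matrixP => i j; rewrite mxE.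
have := congr1 (fun M : 'M_m => M i i) h; rewrite !mxE.
under eq_bigr do rewrite !mxE -normCK.
move/psumr_eq0P => /(_ (fun _ _ => exprn_ge0 _ (normr_ge0 _)) j isT).
by move/eqP; rewrite expf_eq0 /= normr_eq0 => /eqP.
Qed.

Lemma gram_unit (m n : nat) (A : 'M[C]_(m, n)) :
  row_free A -> A *m A^t* \in unitmx.
Proof.
move=> fA; rewrite -row_free_unit -kermx_eq0; apply/eqP.
set K := kermx _; have KA : K *m A = 0.
  by apply: gram_eq0; rewrite trmxC_mul -!mulmxA mulmxA (mulmxA A)
    !mulmxA -(mulmxA K) mulmx_ker mul0mx.
by apply: (row_free_inj fA); rewrite mul0mx.
Qed.

Lemma gram_unitl (m n : nat) (A : 'M[C]_(m, n)) :
  row_full A -> A^t* *m A \in unitmx.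
Proof.
move=> fA; rewrite -{2}[A]trmxCK; apply: gram_unit.
by rewrite /row_free mxrank_map mxrank_tr.
Qed.

End ConjTranspose.

Section MoorePenrose.
Variables (C : numClosedFieldType) (m n : nat).
Implicit Types (A : 'M[C]_(m, n)) (X : 'M[C]_(n, m)).

Definition is_mpinv A X : bool :=
  [&& A *m X *m A == A,
      X *m A *m X == X,
      (A *m X)^t* == A *m X &
      (X *m A)^t* == X *m A].

Lemma mpinv_full_rank (r : nat) (L : 'M[C]_(m, r)) (Q : 'M[C]_(r, n)) :
  row_full L -> row_free Q -> exists X, is_mpinv (L *m Q) X.
Proof.
move=> /gram_unitl uL /gram_unit uQ.
pose Li := invmx (L^t* *m L) *m L^t*; pose Qi := Q^t* *m invmx (Q *m Q^t*).
have LiL : Li *m L = 1%:M by rewrite -mulmxA mulVmx.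
have QQi : Q *m Qi = 1%:M by rewrite mulmxA mulmxV.
have hinv p (M : 'M[C]_p) : M^t* = M -> (invmx M)^t* = invmx M.
  by move=> h; rewrite trmx_inv map_invmx h.
have AX : L *m Q *m (Qi *m Li) = L *m Li.
  by rewrite -mulmxA (mulmxA Q) QQi mul1mx.
have XA : Qi *m Li *m (L *m Q) = Qi *m Q.
  by rewrite -mulmxA (mulmxA Li) LiL mul1mx.
exists (Qi *m Li); apply/and4P; rewrite AX XA; split; apply/eqP.
- by rewrite mulmxA -(mulmxA L) LiL mulmx1.
- by rewrite mulmxA -(mulmxA Qi) QQi mulmx1.
- by rewrite /Li !trmxC_mul trmxCK hinv ?mulmxA // trmxC_mul trmxCK.
- by rewrite /Qi !trmxC_mul trmxCK hinv ?mulmxA // trmxC_mul trmxCK.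
Qed.

Lemma mpinv_exists A : exists X, is_mpinv A X.
Proof.
rewrite -(mulmx_base A).
exact: mpinv_full_rank (col_base_full A) (row_base_free A).
Qed.

Lemma is_mpinv_uniq A X Y : is_mpinv A X -> is_mpinv A Y -> X = Y.
Proof.
move=> /and4P[/eqP aX /eqP xX /eqP lX /eqP rX].
move=> /and4P[/eqP aY /eqP xY /eqP lY /eqP rY].
have eL : A *m X = A *m Y.
  by rewrite -lX -{1}aY -(mulmxA (A *m Y)) trmxC_mul lX lY mulmxA aX.
have eR : X *m A = Y *m A.
  by rewrite -rX -{1}aY -mulmxA mulmxA trmxC_mul rX rY -mulmxA (mulmxA A) aX.
by rewrite -xX -mulmxA eL mulmxA eR xY.
Qed.

Definition mpinv A : 'M[C]_(n, m) := xchoose (mpinv_exists A).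

Lemma mpinvP A : is_mpinv A (mpinv A).
Proof. exact: (xchooseP (mpinv_exists A)). Qed.

End MoorePenrose.

Section CoreEP.
Variables (C : numClosedFieldType) (n : nat).
Implicit Types A X : 'M[C]_n.

Definition is_core_ep A X : bool :=
  [&& X *m A *m X == X,
      same_colspace X (A ^+ mxindex A) &
      same_colspace (A ^+ mxindex A) (X^t*)].

Lemma core_ep_exists A : exists X, is_core_ep A X.
Proof.
rewrite /is_core_ep; have := drazinP A; rewrite /is_drazin.
set k := mxindex A; set D := drazin A; set M := A ^+ k.
move=> /and3P[/eqP cD /eqP iD /eqP kD].
have /and4P[/eqP m1 /eqP m2 /eqP m3 _] := mpinvP M.
set N := mpinv M in m1 m2 m3; pose P := M *m N.
have ADM : A *m D *m M = M by rewrite cD -mulmxA mulmxE -exprS.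
have PM : P *m M = M by [].
have DM : D = M *m D ^+ k.+1.
  rewrite mulmxE /M; elim: (k) => [|j IH]; first by rewrite mul1r.
  rewrite exprS -mulrA exprSr (mulrA (A ^+ j)) -IH mulrA.
  by rewrite -[LHS]iD -cD mulmxE.
have PD : P *m D = D by rewrite DM mulmxA PM.
have PP : P *m P = P by rewrite {2}/P mulmxA PM.
have ADP : A *m D *m P = P by rewrite mulmxA ADM.
exists (D *m P); apply/and3P; split.
- by rewrite -(mulmxA (D *m P) A) (mulmxA A D) ADP -(mulmxA D) PP.
- apply/same_colspaceP; split.
    by exists (D ^+ k.+1 *m P); rewrite mulmxA -DM.
  have eS : A ^+ k.+1 = M *m A by rewrite mulmxE -exprSr.
  by exists (A ^+ k.+1); rewrite eS -(mulmxA D) (mulmxA P) PM -eS kD.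
- apply/same_colspaceP; split.
    by exists (A^t* *m M); rewrite mulmxA -trmxC_mul mulmxA ADP m3.
  by exists (N *m D^t*); rewrite trmxC_mul m3 mulmxA.
Qed.

Lemma core_ep_fix A X : is_core_ep A X ->
  X *m A *m A ^+ mxindex A = A ^+ mxindex A.
Proof.
move=> /and3P[/eqP xX /same_colspaceP[_ [Z ->]] _].
by rewrite mulmxA xX.
Qed.

Lemma core_ep_proj A X : is_core_ep A X ->
  A *m X *m A ^+ mxindex A = A ^+ mxindex A.
Proof.
move=> hX; have := core_ep_fix hX; have := drazinP A; rewrite /is_drazin.
set k := mxindex A; set D := drazin A; set M := A ^+ k.
move=> /and3P[/eqP cD /eqP iD /eqP kD] XAM.
have AM : A *m M = M *m A by rewrite !mulmxE -exprS exprSr.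
have ADM : A *m D *m M = M by rewrite cD -mulmxA mulmxE -exprS.
have DM : D *m M = M *m D.
  by rewrite !mulmxE; apply: commrX; rewrite /GRing.comm -!mulmxE cD.
have eM : M = A *m M *m D by rewrite -mulmxA -DM mulmxA.
by rewrite {1}eM -(mulmxA A X) (mulmxA X) (mulmxA X A) XAM mulmxA -eM.
Qed.

Lemma core_ep_herm A X : is_core_ep A X -> (A *m X)^t* = A *m X.
Proof.
move=> hX; have AXM := core_ep_proj hX.
have /and3P[_ _ /same_colspaceP[_ [Z eZ]]] := hX.
have h : A *m X *m (A *m X)^t* = (A *m X)^t*.
  by rewrite trmxC_mul eZ -(mulmxA _ Z) (mulmxA (A *m X)) AXM.
by have := congr1 (fun M => M^t*) h; rewrite /= (trmxC_mul (A *m X)) trmxCK h.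
Qed.

Lemma is_core_ep_uniq A X Y : is_core_ep A X -> is_core_ep A Y -> X = Y.
Proof.
move=> hX hY.
have absorb U V : is_core_ep A U -> is_core_ep A V -> U *m A *m V = V.
  move=> hU /and3P[_ /same_colspaceP[[Z ->] _] _].
  by rewrite mulmxA core_ep_fix.
have prod U V : is_core_ep A U -> is_core_ep A V ->
    A *m U *m (A *m V) = A *m V.
  by move=> hU hV; rewrite -mulmxA (mulmxA U) absorb.
have e : A *m X = A *m Y.
  rewrite -(core_ep_herm hX) -(prod Y X) // (trmxC_mul (A *m Y)).
  by rewrite !core_ep_herm // prod.
have /and3P[/eqP xX _ _] := hX.
by rewrite -xX -mulmxA e mulmxA absorb.
Qed.

Definition core_ep A : 'M[C]_n := xchoose (core_ep_exists A).

Lemma core_epP A : is_core_ep A (core_ep A).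
Proof. exact: (xchooseP (core_ep_exists A)). Qed.

Definition CEPD A : Prop := core_ep A *m drazin A = drazin A *m core_ep A.

Definition k_EP (k : nat) A : Prop := A ^+ k *m mpinv A = mpinv A *m A ^+ k.

End CoreEP.

(* Main.v *)
Require Import Defs.
From mathcomp Require Import all_boot all_order all_algebra.
From mathcomp Require Import complex reals.

(** Write [A^t*] for the conjugate transpose and [R] for the column space.  If
[A^k] and [(A^k)^t*] have the same column space for [k = ind A], then the Drazin
inverse satisfies the defining conditions of the core EP inverse.  For this it
suffices to find an orthogonal projector onto both spaces.  Let [N] be the
Moore-Penrose inverse of [A], and let [P = A N] and [Q = N A] be the orthogonal
projectors onto [R A] and [R A^t*].  For [k = 1] take [P = Q].  For [k = 2] take
[E = Q P = N A^2 N]: as [A^2] commutes with [N], [E = A^2 N^2], so [P E = E],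
i.e. [P Q P = Q P]; hence [E] is Hermitian and idempotent. *)

Set Implicit Arguments.
Unset Strict Implicit.
Unset Printing Implicit Defensive.

Import Order.TTheory GRing.Theory Num.Theory.
Local Open Scope ring_scope.
Local Open Scope sesquilinear_scope.

(** Iterates D = A D^2, a consequence of D A D = D and A D = D A; it puts R(D) inside R(A^k). *)
Lemma drazin_factor (F : fieldType) (n : nat) (A : 'M[F]_n) :
  drazin A = A ^+ mxindex A *m drazin A ^+ (mxindex A).+1.
Proof.
have := drazinP A; rewrite /is_drazin.
set D := drazin A => /and3P[/eqP cD /eqP iD _].
elim: (mxindex A) => [|k IH]; first by rewrite mulmxE mul1r.
rewrite mulmxE in IH *.
by rewrite exprS -mulrA exprSr (mulrA (A ^+ k)) -IH mulrA -[LHS]iD -cD mulmxE.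
Qed.

Lemma core_ep_eq_drazin (C : numClosedFieldType) (n : nat) (A : 'M[C]_n) :
  same_colspace (A ^+ mxindex A) ((A ^+ mxindex A)^t*) ->
  core_ep A = drazin A.
Proof.
move=> /same_colspaceP[[Y eY] [Z eZ]].
apply: is_core_ep_uniq (core_epP A) _; have eD := drazin_factor A.
have := drazinP A; rewrite /is_drazin => /and3P[/eqP cD /eqP iD /eqP kD].
have cX i j : A ^+ i *m drazin A ^+ j = drazin A ^+ j *m A ^+ i.
  by rewrite !mulmxE; apply/commrX/commr_sym/commrX/commr_sym.
have kD' : A ^+ mxindex A = A ^+ (mxindex A).+1 *m drazin A.
  by have := cX (mxindex A).+1 1%N; rewrite expr1 => ->; rewrite kD.
apply/and3P; split; first exact/eqP.
- apply/same_colspaceP; split; first by eexists; exact: eD.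
  by exists (A ^+ (mxindex A).+1); rewrite kD.
(* The adjoints of A^k = A^(k+1) D and D = D^(k+1) A^k relate D^t* to (A^k)^t*; [Y] and [Z] then
   exchange (A^k)^t* for A^k. *)
- apply/same_colspaceP; split.
    exists ((A ^+ (mxindex A).+1)^t* *m Y).
    by rewrite mulmxA -trmxC_mul -kD'.
  exists (Z *m (drazin A ^+ (mxindex A).+1)^t*).
  by rewrite mulmxA -eZ -trmxC_mul -cX -eD.
Qed.

(** Taking adjoints, M E = M and E = V M become E M^t* = M^t* and E = M^t* V^t*, so both column
    spaces equal R(E). *)
Lemma same_colspace_ctrmx (C : numClosedFieldType) (n : nat)
    (M E U V : 'M[C]_n) :
  E^t* = E -> E *m M = M -> M *m E = M -> E = M *m U -> E = V *m M ->
  same_colspace M (M^t*).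
Proof.
move=> hE EM ME eU eV; apply/same_colspaceP; split.
  by exists (V^t* *m M); rewrite mulmxA -trmxC_mul -eV hE.
exists (U *m M^t*).
by rewrite mulmxA -eU -[in RHS]hE -trmxC_mul ME.
Qed.

Lemma same_colspace_1EP (C : numClosedFieldType) (n : nat) (A : 'M[C]_n) :
  k_EP 1 A -> same_colspace A (A^t*).
Proof.
rewrite /k_EP expr1 => c.
have /and4P[/eqP ANA _ /eqP hP _] := mpinvP A.
apply: (same_colspace_ctrmx hP ANA _ erefl c).
by rewrite c mulmxA.
Qed.

Lemma same_colspace_2EP (C : numClosedFieldType) (n : nat) (A : 'M[C]_n) :
  k_EP 2 A -> same_colspace (A ^+ 2) ((A ^+ 2)^t*).
Proof.
rewrite /k_EP; have /and4P[/eqP ANA _ /eqP hP /eqP hQ] := mpinvP A.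
set N := mpinv A in ANA hP hQ *; rewrite expr2 -mulmxE => c.
pose P := A *m N; pose Q := N *m A; pose E := Q *m P.
have PM : P *m (A *m A) = A *m A by rewrite mulmxA ANA.
have MQ : A *m A *m Q = A *m A by rewrite -mulmxA (mulmxA A N) ANA.
(* By [c], Q A^2 = (N A^2) A = A^2 N A = A^2 Q. *)
have QM : Q *m (A *m A) = A *m A.
  by rewrite /Q -mulmxA (mulmxA A A A) (mulmxA N (A *m A)) -c -mulmxA MQ.
have MP : A *m A *m P = A *m A.
  by rewrite /P -mulmxA (mulmxA A A N) c mulmxA PM.
have eN : E = N *m (A *m A) *m N by rewrite /E /P /Q !mulmxA.
have eU : E = A *m A *m (N *m N) by rewrite eN -c mulmxA.
have eV : E = N *m N *m (A *m A) by rewrite eN -mulmxA c mulmxA.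
have PE : P *m E = E by rewrite eU mulmxA PM.
(* [PE] reads E = P Q P, which is its own adjoint. *)
have hE : E^t* = E.
  by rewrite -{1}PE trmxC_mul (trmxC_mul Q) hP hQ -mulmxA PE.
apply: (same_colspace_ctrmx hE _ _ eU eV).
- by rewrite /E -mulmxA PM.
- by rewrite /E mulmxA MQ.
Qed.

Theorem theorem3p5 (R : realType) (n : nat) (A : 'M[R[i]]_n)
    (index_le2 : (mxindex A <= 2)%N) (A_kEP : k_EP (mxindex A) A) :
  core_ep A = drazin A /\ CEPD A.
Proof.
suff e : core_ep A = drazin A by rewrite /CEPD e.
apply: core_ep_eq_drazin.
case: (mxindex A) index_le2 A_kEP => [|[|[|//]]] _.
- by rewrite expr0 trmx1 map_mx1 => _; apply/andP.
- exact: same_colspace_1EP.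
- exact: same_colspace_2EP.
Qed.
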